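(* In general, it is impossible to construct, using a ruler and compass, a square of the same area as a triangle with given lengths of (internal) angle bisectors. That is, it is not true that for every triple of positive real numbers $l_a,l_b,l_c$, given segments of lengths $l_a,l_b,l_c$, one can construct with ruler and compass a segment of length $\sqrt{S}$, where $S$ is the area of the triangle whose internal angle bisectors have lengths $l_a,l_b,l_c$.
   Context: For a triangle $ABC$ in the Euclidean plane with $BC=a$, $AC=b$, $AB=c$, let $l_a,l_b,l_c$ denote the lengths of the internal angle bisectors (segments from a vertex to the opposite side) drawn to the sides $a,b,c$ respectively. Known facts: for every triple of positive numbers $l_a,l_b,l_c$ there exists a triangle with these angle bisector lengths, and it is unique up to congruence; hence its area $S$ is a well-defined function of $(l_a,l_b,l_c)\in(0,\infty)^3$. Constructibility convention: given segments of positive lengths $l_a,l_b,l_c$, a segment of length $x>0$ can be constructed with ruler and compass if and only if $x/l_a$ belongs to the smallest subfield of $\mathbb{R}$ that contains $l_b/l_a$ and $l_c/l_a$ and is closed under taking square roots of its positive elements. *)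

(* Defs.v *)
From HB Require Import structures.
From mathcomp Require Import all_boot all_order all_algebra.
From mathcomp Require Import boolp classical_sets reals trigo.

Set Implicit Arguments.
Unset Strict Implicit.
Unset Printing Implicit Defensive.

Import Order.TTheory GRing.Theory Num.Theory.
Local Open Scope classical_set_scope.
Local Open Scope ring_scope.

Definition dotp (R : realType) (u v : 'rV[R]_2) : R :=
  \sum_(i < 2) u 0 i * v 0 i.

(* The library norm on 'rV_2 is the sup norm, hence this definition. *)
Definition enorm (R : realType) (u : 'rV[R]_2) : R := Num.sqrt (dotp u u).

Definition edist (R : realType) (P Q : 'rV[R]_2) : R := enorm (Q - P).

(* Unoriented angle P V Q at the vertex V, in [0, pi]; meaningful only when
   P != V and Q != V. *)
Definition angle (R : realType) (P V Q : 'rV[R]_2) : R :=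
  acos (dotp (P - V) (Q - V) / (enorm (P - V) * enorm (Q - V))).

Definition on_segment (R : realType) (P Q X : 'rV[R]_2) : Prop :=
  exists t : R, 0 <= t <= 1 /\ X = (1 - t) *: P + t *: Q.

Definition edges (R : realType) (A B C : 'rV[R]_2) : 'M[R]_2 :=
  col_mx (B - A) (C - A).

(* Non-degeneracy: A, B, C are affinely independent. *)
Definition triangle (R : realType) (A B C : 'rV[R]_2) : bool :=
  row_free (edges A B C).

Definition area (R : realType) (A B C : 'rV[R]_2) : R :=
  `|\det (edges A B C)| / 2.

(* The internal bisector AD issued from A, with D on the side BC, has
   length l. *)
Definition bisector_length (R : realType) (A B C : 'rV[R]_2) (l : R) : Prop :=
  exists D : 'rV[R]_2,
    [/\ on_segment B C D, angle B A D = angle D A C & edist A D = l].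

Definition has_bisectors (R : realType) (A B C : 'rV[R]_2) (la lb lc : R)
    : Prop :=
  [/\ bisector_length A B C la, bisector_length B C A lb
    & bisector_length C A B lc].

(* Since 0^-1 = 0, closure under x / y for all y only demands inverses of
   nonzero elements, so [divring_closed] says that K is a subfield of R. *)
Definition sqrt_closed_subfield (R : realType) (K : set R) : Prop :=
  divring_closed [in K] /\ forall x : R, K x -> 0 < x -> K (Num.sqrt x).

Definition sqrt_closure (R : realType) (G : set R) : set R :=
  smallest (@sqrt_closed_subfield R) G.

(* A segment of length x > 0 is constructible with ruler and compass from
   segments of lengths la, lb, lc; la serves as the unit. *)
Definition constructible (R : realType) (la lb lc x : R) : Prop :=
  sqrt_closure [set lb / la; lc / la] (x / la).

(* Main.v *)
Require Import Defs.
From HB Require Import structures.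
From mathcomp Require Import all_boot all_order all_algebra.
From mathcomp Require Import boolp classical_sets reals trigo.
From mathcomp Require Import ring lra zify.

(** One isosceles triangle suffices, with base BC, apex A and
    la : lb : lc = 2 : 1 : 1.  All the given ratios are then rational, so the
    constructible lengths form the square-root closure of the rationals.

    Write beta for the base angle and u = 2 sin (beta / 2).  With legs of
    length 2 the base is 2 (2 - u^2) and the bisector from the apex is the
    height h = u sqrt (4 - u^2).  The formula for a bisector in terms of the
    sides ([bisector_length_sides]) shows that the bisectors from B and C equal
    h / 2 exactly when u^3 - 4 u^2 - 3 u + 8 = 0.  This cubic has a root
    between 1 and 7/5, for which u^2 < 2 and the triangle exists
    ([isosceles_triangle]).  It has no rational root ([rat_rootfree]).

    If sqrt S were constructible, so would be S / h^2 = cot beta, hence also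
    h^2 = 4 / (1 + cot^2 beta).  Modulo the cubic, 32 - h^2 = 15 u^2 + 4 u, and
    solving this quadratic equation makes u constructible
    ([root_in_sqrt_closed_subfield]).

    But a cubic over a field K without a root in K acquires none in a quadratic
    extension K(w): if a + b w is a root, so is a - b w, and the third root is
    then in K because the sum of the roots is ([cubic_root_descends]).  Instead
    of building towers of such extensions, Zorn's lemma provides a maximal
    subfield of the reals in which the cubic has no root.  By the previous
    remark it is closed under square roots, so it contains every constructible
    number, and u cannot be one ([cubic_rootfree_sqrt_closure]). *)

Set Implicit Arguments.
Unset Strict Implicit.
Unset Printing Implicit Defensive.

Import Order.TTheory GRing.Theory Num.Theory.
Local Open Scope classical_set_scope.
Local Open Scope ring_scope.

(** * Cubics over quadratic extensions *)

Definition cubic (F : nzRingType) (p q r x : F) : F :=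
  x ^+ 3 + p * x ^+ 2 + q * x + r.

Lemma rmorph_cubic (F F' : nzRingType) (f : {rmorphism F -> F'})
    (p q r x : F) :
  f (cubic p q r x) = cubic (f p) (f q) (f r) (f x).
Proof. by rewrite /cubic !rmorphD (rmorphM f p) (rmorphM f q) !rmorphXn. Qed.

(** The conjugate a - b w is a root as well, and the three roots sum to - p, so
    the third one is - p - 2 a.  The proof compares the coefficients of 1 and w
    in the value of the cubic at a + b w, which avoids factoring it. *)
Lemma cubic_root_descends (F : fieldType) (K : divringClosed F)
    (p q r a b d w : F) :
  p \in K -> q \in K -> r \in K -> a \in K -> b \in K ->
  d \in K -> w ^+ 2 = d -> w \notin K -> cubic p q r (a + b * w) = 0 ->
  exists2 x, x \in K & cubic p q r x = 0.
Proof.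
move=> pK qK rK aK bK dK w2 wK root_abw.
have [b0|b_neq0] := eqVneq b 0.
  by exists a => //; rewrite b0 mul0r addr0 in root_abw.
pose coef1 := cubic p q r a + b ^+ 2 * d * (3%:R * a + p).
pose coefw := b * (3%:R * a ^+ 2 + b ^+ 2 * d + 2%:R * p * a + q).
have coef1K : coef1 \in K.
  by rewrite /coef1 /cubic !(rpred1, rpredD, rpredM, rpredX).
have coefwK : coefw \in K.
  by rewrite /coefw !(rpred1, rpredD, rpredM, rpredX).
have splitE : coef1 + coefw * w = 0.
  by rewrite -root_abw /coef1 /coefw /cubic -w2; ring.
have coefw0 : coefw = 0.
  apply: contraNeq wK => coefw_neq0.
  have -> : w = - coef1 / coefw.
    apply/(canRL (mulfK coefw_neq0)).
    by rewrite mulrC -(addKr coef1 (_ * _)) splitE addr0.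
  by rewrite rpred_div // rpredN.
have coef10 : coef1 = 0 by rewrite -splitE coefw0 mul0r addr0.
exists (- p - 2%:R * a).
  by rewrite !(rpredB, rpredN, rpredM, rpredD, rpred1).
have norm_bw : b ^+ 2 * d = - (3%:R * a ^+ 2 + 2%:R * p * a + q).
  have /eqP := coefw0; rewrite mulf_eq0 (negPf b_neq0) /= => /eqP s0.
  by rewrite -[LHS]subr0 -s0; ring.
by rewrite -coef10 /coef1 norm_bw /cubic; ring.
Qed.

Definition adjoin (F : fieldType) (K : set F) (w : F) : set F :=
  [set x | exists a b, [/\ K a, K b & x = a + b * w]].

(** Packs a subfield given as a set, so that the [rpred] lemmas apply to it. *)
Definition divring_of (F : fieldType) (K : set F)
    (HK : divring_closed [in K]) : divringClosed F :=
  HB.pack [in K] (GRing.isDivringClosed.Build F [in K] HK).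

(** Inverses come from multiplying by the conjugate a' - b' w.  It is nonzero
    along with a' + b' w: otherwise either b' = 0, and both elements equal a',
    or w = a' / b' is in K. *)
Lemma divring_closed_adjoin (F : fieldType) (K : set F) (d w : F) :
  divring_closed [in K] -> K d -> w ^+ 2 = d -> ~ K w ->
  divring_closed [in adjoin K w].
Proof.
move=> HK dK w2 wK; pose k := divring_of HK.
have inK x : K x <-> x \in k by split=> [/mem_set|/set_mem].
move: dK wK => /inK dK wK.
split.
- apply/mem_set; exists 1, 0; rewrite mul0r addr0.
  by split=> //; apply/inK; rewrite ?rpred1 ?rpred0.
- move=> _ _ /set_mem[a [b [/inK aK /inK bK ->]]]
    /set_mem[a' [b' [/inK aK' /inK bK' ->]]].
  apply/mem_set; exists (a - a'), (b - b').
  by split; [apply/inK; rewrite rpredB..|ring].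
move=> _ _ /set_mem[a [b [/inK aK /inK bK ->]]]
  /set_mem[a' [b' [/inK aK' /inK bK' ->]]].
apply/mem_set; have [y0|y_neq0] := eqVneq (a' + b' * w) 0.
  exists 0, 0; rewrite y0 invr0 mulr0 mul0r addr0.
  by split=> //; apply/inK; rewrite rpred0.
have conj_neq0 : a' - b' * w != 0.
  apply: contra_notN wK => /eqP conj0.
  have [b0|b_neq0] := eqVneq b' 0.
    by move: y_neq0; rewrite -conj0 b0 !mul0r subr0 addr0 eqxx.
  by apply/inK; rewrite -[w](mulKf b_neq0) -(subr0_eq conj0) rpredM ?rpredV.
pose norm := a' ^+ 2 - b' ^+ 2 * d.
have normE : norm = (a' - b' * w) * (a' + b' * w) by rewrite /norm -w2; ring.
have normK : norm \in k by rewrite rpredB ?rpredM ?rpredX.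
exists ((a * a' - b * b' * d) / norm), ((b * a' - a * b') / norm); split.
- by apply/inK; rewrite rpred_div ?rpredB ?rpredM.
- by apply/inK; rewrite rpred_div ?rpredB ?rpredM.
by rewrite normE -w2; field; rewrite y_neq0 conj_neq0.
Qed.

(** A maximal root-free subfield is closed under square roots, since adjoining
    a missing one would give a larger root-free subfield.  Zorn's lemma is
    applied to the sets M such that K together with M is a root-free subfield:
    the empty chain then causes no difficulty, as M may be empty. *)
Lemma cubic_rootfree_sqrt_closure (R : realType) (K G : set R) (p q r : R) :
  divring_closed [in K] -> K p -> K q -> K r ->
  (forall x, K x -> cubic p q r x <> 0) -> G `<=` K ->
  forall x, sqrt_closure G x -> cubic p q r x <> 0.
Proof.
move=> K_divring Kp Kq Kr K_rootfree GK.
pose good M := divring_closed [in K `|` M] /\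
  forall x, (K `|` M) x -> cubic p q r x <> 0.
have [|M [[M_divring M_rootfree] M_max]] := @Zorn_bigcup R good.
  move=> C C_good C_chain.
  have directed x y : (K `|` \bigcup_(X in C) X) x ->
      (K `|` \bigcup_(X in C) X) y ->
      exists X, [/\ good X, X `<=` \bigcup_(X in C) X,
        (K `|` X) x & (K `|` X) y].
    have upper X : C X -> X `<=` \bigcup_(X in C) X by move=> CX z Xz; exists X.
    move=> [Kx|[X CX Xx]] [Ky|[Y CY Yy]].
    - by exists set0; split; rewrite /good ?setU0.
    - by exists Y; split; [exact: C_good|exact: upper|left|right].
    - by exists X; split; [exact: C_good|exact: upper|right|left].
    have [XY|YX] := C_chain _ _ CX CY.
      by exists Y; split; [exact: C_good|exact: upper|right; exact: XY|right].
    by exists X; split; [exact: C_good|exact: upper|right|right; exact: YX].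
  split; last first.
    by move=> x Cx; have [X [[_ +] _ Xx _]] := directed x x Cx Cx; apply.
  split; first by apply/mem_set; left; case: K_divring => /set_mem.
    move=> x y /set_mem Cx /set_mem Cy.
    have [X [[[_ XB _] _] XC Xx Xy]] := directed x y Cx Cy.
    by apply/mem_set; apply: setUS XC _ _; apply/set_mem/XB; apply/mem_set.
  move=> x y /set_mem Cx /set_mem Cy.
  have [X [[[_ _ XV] _] XC Xx Xy]] := directed x y Cx Cy.
  by apply/mem_set; apply: setUS XC _ _; apply/set_mem/XV; apply/mem_set.
move=> x Gx; apply: (M_rootfree).
apply: smallest_sub x Gx; last by move=> x /GK; left.
split=> // d Md d_gt0; apply: contrapT => Mw.
set w := Num.sqrt d in Mw.
have w2 : w ^+ 2 = d by rewrite sqr_sqrtr // ltW.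
have [M0 _ _] := M_divring.
have inL x : (K `|` M) x -> adjoin (K `|` M) w x.
  move=> Mx; exists x, 0; split=> //; last by rewrite mul0r addr0.
  by apply/set_mem; exact: (rpred0 (divring_of M_divring)).
have KL : K `|` adjoin (K `|` M) w = adjoin (K `|` M) w.
  by apply: setUidr => x Kx; apply: inL; left.
apply: (M_max (adjoin (K `|` M) w)).
  split; last first.
    move=> /(_ w) /= wM; apply: Mw; right; apply: wM.
    exists 0, 1; rewrite mul1r add0r; split=> //; apply/set_mem => //.
    exact: (rpred0 (divring_of M_divring)).
  by move=> x Mx; apply: inL; right.
rewrite /good KL; split.
  exact: divring_closed_adjoin w2 _.
move=> _ [a [b [Ma Mb ->]]] root_abw.
have inM x : (K `|` M) x <-> x \in divring_of M_divring.
  by split=> [/mem_set|/set_mem].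
have KM x : K x -> x \in divring_of M_divring by move=> Kx; apply/inM; left.
have [x /inM Mx] : exists2 x, x \in divring_of M_divring & cubic p q r x = 0.
  have wNM : w \notin divring_of M_divring by apply/negP => /inM.
  exact: (cubic_root_descends (KM p Kp) (KM q Kq) (KM r Kr)
    ((inM a).1 Ma) ((inM b).1 Mb) ((inM d).1 Md) w2 wNM root_abw).
exact: M_rootfree.
Qed.

(** * A cubic without rational roots *)

Definition ratrs (R : realType) : set R := range (@ratr R).

Lemma divring_closed_ratrs (R : realType) : divring_closed [in @ratrs R].
Proof.
split; first by apply/mem_set; exists 1; rewrite ?rmorph1.
  move=> _ _ /set_mem[x _ <-] /set_mem[y _ <-]; apply/mem_set.
  by exists (x - y); rewrite ?rmorphB.
move=> _ _ /set_mem[x _ <-] /set_mem[y _ <-]; apply/mem_set.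
by exists (x / y); rewrite ?fmorph_div.
Qed.

(** The value is positive for n at least 5 and negative for n below - 1, which
    leaves six integers to try. *)
Lemma int_rootfree (n : int) : cubic (- 4) (- 3) 8 n <> 0.
Proof.
have -> : cubic (- 4) (- 3) 8 n = n * (n * (n - 4) - 3) + 8.
  by rewrite /cubic; ring.
have [n_big|n_lt5] := leP 5 n.
  have : 0 < n * (n * (n - 4) - 3) by rewrite mulr_gt0 //; nia.
  lia.
have [n_small|n_geN1] := ltP n (- 1); first by nia.
have : n \in [:: -1; 0; 1; 2; 3; 4] by rewrite !inE; lia.
by rewrite !inE; do ?[case/predU1P => [-> //|]]; move/eqP->.
Qed.

(** The cubic is monic with integer coefficients, so the denominator of a
    rational root divides the cube of its numerator and is therefore 1. *)
Lemma rat_rootfree (x : rat) : cubic (- 4) (- 3) 8 x <> 0.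
Proof.
move=> x_root.
set n := numq x; set d := denq x.
have d_neq0 : (d%:~R : rat) != 0 by rewrite intr_eq0 denq_neq0.
have homog : n ^+ 3 = d * (4 * n ^+ 2 + 3 * n * d - 8 * d ^+ 2).
  apply: (@intr_inj rat).
  rewrite !(rmorphD, rmorphB, rmorphM, rmorphXn) /=.
  have nE : (n%:~R : rat) = x * d%:~R by rewrite -[x in RHS]divq_num_den divfK.
  apply/eqP; rewrite -subr_eq0 nE; apply/eqP.
  by rewrite -[RHS](mulr0 (d%:~R ^+ 3)) -x_root /cubic; ring.
have d_dvd : (`|d| %| `|n| ^ 3)%N by rewrite -abszX homog abszM dvdn_mulr.
have d1 : d = 1.
  have cop : coprime `|d| (`|n| ^ 3).
    by rewrite coprimeXr // coprime_sym coprime_num_den.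
  have : `|d|%N = 1%N by apply/eqP; rewrite -(gcdn_idPl d_dvd).
  by have := denq_gt0 x; rewrite -/d; lia.
apply: (@int_rootfree n); move: homog; rewrite d1 /cubic => homog.
by rewrite homog; ring.
Qed.

(** The bound 7/5 is below the square root of 2: the base 2 (2 - u^2) of the
    triangle has to be positive. *)
Lemma cubic_real_root (R : rcfType) :
  exists2 u : R, 1 <= u <= 7 / 5 & cubic (- 4) (- 3) 8 u = 0.
Proof.
pose p : {poly R} := - ('X^3 - 4%:R *: 'X^2 - 3%:R *: 'X + 8%:R%:P).
have pE x : p.[x] = - cubic (- 4) (- 3) 8 x.
  rewrite /p !(hornerN, hornerD, hornerZ, hornerXn, hornerX, hornerC) /cubic.
  by ring.
have [||u u_itv] := @poly_ivt R p 1 (7 / 5).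
- by lra.
- by rewrite !pE /cubic; apply/andP; split; nra.
by rewrite /root pE oppr_eq0 => /eqP u_root; exists u.
Qed.

(** * Angle bisectors from side lengths *)

Lemma dotpE (R : realType) (u v : 'rV[R]_2) :
  dotp u v = u 0 0 * v 0 0 + u 0 1 * v 0 1.
Proof.
rewrite /dotp !big_ord_recl big_ord0 addr0.
by congr (_ + u _ _ * v _ _); apply: val_inj.
Qed.

Lemma enorm_dotp (R : realType) (u : 'rV[R]_2) (l : R) :
  0 <= l -> dotp u u = l ^+ 2 -> enorm u = l.
Proof. by move=> l_ge0 uu; rewrite /enorm uu sqrtr_sqr ger0_norm. Qed.

Lemma sqr_enorm (R : realType) (u : 'rV[R]_2) : enorm u ^+ 2 = dotp u u.
Proof. by rewrite sqr_sqrtr // dotpE addr_ge0 // -expr2 sqr_ge0. Qed.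

(** The foot D divides BC in the ratio c : b, so that D - A is proportional to
    b (B - A) + c (C - A), a sum of two vectors of the same length b c.  Its
    length follows from the law of cosines, here in the form of the dot product
    of (B - A) and (C - A). *)
Lemma bisector_length_sides (R : realType) (A B C : 'rV[R]_2) (a b c : R) :
  0 < b -> 0 < c -> edist B C = a -> edist A C = b -> edist A B = c ->
  bisector_length A B C
    (Num.sqrt (b * c * ((b + c) ^+ 2 - a ^+ 2)) / (b + c)).
Proof.
move=> b_gt0 c_gt0 BC AC AB.
have bc_gt0 : 0 < b + c by rewrite addr_gt0.
have bc_neq0 : b + c != 0 by rewrite gt_eqF.
have b_neq0 : b != 0 by rewrite gt_eqF.
have c_neq0 : c != 0 by rewrite gt_eqF.
have a2 : a ^+ 2 = dotp (C - B) (C - B) by rewrite -sqr_enorm -BC.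
have b2 : b ^+ 2 = dotp (C - A) (C - A) by rewrite -sqr_enorm -AC.
have c2 : c ^+ 2 = dotp (B - A) (B - A) by rewrite -sqr_enorm -AB.
pose D := A + (b + c)^-1 *: (b *: (B - A) + c *: (C - A)).
have DA : D - A = (b + c)^-1 *: (b *: (B - A) + c *: (C - A)).
  by rewrite addrC addKr.
exists D; split.
- exists (c / (b + c)); split.
    apply/andP; split; first by rewrite divr_ge0 ?ltW.
    by rewrite ler_pdivrMr // mul1r lerDr ltW.
  by apply/rowP => j; rewrite !mxE; field.
- pose m := (b * c + dotp (B - A) (C - A)) / (b + c).
  have BAD : dotp (B - A) (D - A) = c * m.
    have -> : c * m = (b * c ^+ 2 + c * dotp (B - A) (C - A)) / (b + c).
      by rewrite /m; ring.
    by rewrite c2 DA !dotpE !mxE; field.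
  have DAC : dotp (D - A) (C - A) = b * m.
    have -> : b * m = (c * b ^+ 2 + b * dotp (B - A) (C - A)) / (b + c).
      by rewrite /m; ring.
    by rewrite b2 DA !dotpE !mxE; field.
  rewrite /angle BAD DAC -/(edist A B) -/(edist A C) AB AC [enorm _ * b]mulrC.
  by rewrite -!mulf_div !divff.
have DA2 : dotp (D - A) (D - A) =
    (b + c)^-1 ^+ 2 * (b * c * ((b + c) ^+ 2 - a ^+ 2)).
  have -> : b * c * ((b + c) ^+ 2 - a ^+ 2) =
      b * c * (dotp (C - A) (C - A) + dotp (B - A) (B - A)
               - dotp (C - B) (C - B))
      + b ^+ 2 * dotp (B - A) (B - A) + c ^+ 2 * dotp (C - A) (C - A).
    by rewrite -a2 -b2 -c2; ring.
  by rewrite DA !dotpE !mxE; field.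
rewrite /edist /enorm DA2 sqrtrM ?sqr_ge0 // sqrtr_sqr.
by rewrite ger0_norm ?invr_ge0 ?ltW // mulrC.
Qed.

Definition point (R : realType) (x y : R) : 'rV[R]_2 :=
  \row_j if j == 0 then x else y.

Lemma edist_point (R : realType) (x y x' y' l : R) :
  0 <= l -> (x' - x) ^+ 2 + (y' - y) ^+ 2 = l ^+ 2 ->
  edist (point x y) (point x' y') = l.
Proof.
move=> l_ge0 l2; apply: enorm_dotp => //.
by rewrite -l2 dotpE !mxE /=; ring.
Qed.

Lemma det_edges (R : realType) (A B C : 'rV[R]_2) :
  \det (edges A B C) =
  (B - A) 0 0 * (C - A) 0 1 - (B - A) 0 1 * (C - A) 0 0.
Proof.
have row0 j : edges A B C 0 j = (B - A) 0 j.
  rewrite -[RHS](col_mxEu (B - A) (C - A)).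
  by congr (edges _ _ _ _ _); apply: val_inj.
have row1 j : edges A B C 1 j = (C - A) 0 j.
  rewrite -[RHS](col_mxEd (B - A) (C - A)).
  by congr (edges _ _ _ _ _); apply: val_inj.
have lift00 : lift 0 0 = 1 :> 'I_2 by apply: val_inj.
have lift10 : lift 1 0 = 0 :> 'I_2 by apply: val_inj.
move: (edges A B C) row0 row1 => M row0 row1.
rewrite (expand_det_row _ 0) !big_ord_recl big_ord0 /cofactor !det_mx11.
by rewrite !mxE !ord1 !lift00 !lift10 !row0 !row1 !mxE /=; ring.
Qed.

(** The triangle has legs 2 and base 2 (2 - u^2), that is, 2 cos beta = 2 - u^2
    for the base angle beta.  By [bisector_length_sides] the bisectors from the
    base vertices equal h / 2 if and only if
    4 (2 - u^2) = u (3 - u^2), which is the cubic equation for u. *)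
Lemma isosceles_triangle (R : realType) (u : R) :
  0 < u -> u ^+ 2 < 2 -> cubic (- 4) (- 3) 8 u = 0 ->
  let h := Num.sqrt (u ^+ 2 * (4 - u ^+ 2)) in
  exists A B C : 'rV[R]_2,
  [/\ triangle A B C, has_bisectors A B C h (h / 2) (h / 2)
    & area A B C = (2 - u ^+ 2) * h].
Proof.
move=> u_gt0 u2_lt2 u_root h.
have u2_gt0 : 0 < u ^+ 2 by rewrite exprn_gt0.
have h2 : h ^+ 2 = u ^+ 2 * (4 - u ^+ 2) by rewrite sqr_sqrtr // mulr_ge0; lra.
have h_gt0 : 0 < h by rewrite sqrtr_gt0 mulr_gt0 //; lra.
have w_gt0 : 0 < 2 - u ^+ 2 by lra.
pose A := point 0 h; pose B := point (- (2 - u ^+ 2)) 0.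
pose C := point (2 - u ^+ 2) 0.
have detE : \det (edges A B C) = 2 * ((2 - u ^+ 2) * h).
  by rewrite det_edges !mxE /=; ring.
have det_gt0 : 0 < \det (edges A B C) by rewrite detE !mulr_gt0.
have AB : edist A B = 2.
  by apply: edist_point => //; rewrite sub0r sqrrN h2; ring.
have BA : edist B A = 2 by apply: edist_point => //; rewrite subr0 h2; ring.
have AC : edist A C = 2.
  by apply: edist_point => //; rewrite sub0r sqrrN h2; ring.
have CA : edist C A = 2 by apply: edist_point => //; rewrite subr0 h2; ring.
have BC : edist B C = 2 * (2 - u ^+ 2) by apply: edist_point; [lra|ring].
have CB : edist C B = 2 * (2 - u ^+ 2) by apply: edist_point; [lra|ring].
have wE : 4 * (2 - u ^+ 2) = u * (3 - u ^+ 2).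
  by apply/eqP; rewrite -subr_eq0 -u_root /cubic; apply/eqP; ring.
have bisector P Q S a b c l : 0 < b -> 0 < c -> 0 <= l ->
    edist Q S = a -> edist P S = b -> edist P Q = c ->
    b * c * ((b + c) ^+ 2 - a ^+ 2) = (l * (b + c)) ^+ 2 ->
    bisector_length P Q S l.
  move=> b_gt0 c_gt0 l_ge0 QS PS PQ lE.
  have := bisector_length_sides b_gt0 c_gt0 QS PS PQ.
  have bc_gt0 : 0 < b + c by rewrite addr_gt0.
  by rewrite lE sqrtr_sqr ger0_norm ?mulr_ge0 ?mulfK ?gt_eqF // ltW.
have base_sq : 2 * (2 * (2 - u ^+ 2)) *
    ((2 + 2 * (2 - u ^+ 2)) ^+ 2 - 2 ^+ 2) =
    (h / 2 * (2 + 2 * (2 - u ^+ 2))) ^+ 2.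
  have -> : (h / 2 * (2 + 2 * (2 - u ^+ 2))) ^+ 2 =
     h ^+ 2 * (3 - u ^+ 2) ^+ 2 by field.
  have -> : h ^+ 2 * (3 - u ^+ 2) ^+ 2 =
      (4 - u ^+ 2) * (u * (3 - u ^+ 2)) ^+ 2.
    by rewrite h2; ring.
  by rewrite -wE; ring.
exists A, B, C; split.
- by rewrite /triangle row_free_unit unitmxE unitfE gt_eqF.
- have w2_gt0 : 0 < 2 * (2 - u ^+ 2) by rewrite mulr_gt0.
  have h_ge0 : 0 <= h by exact: ltW.
  have h2_ge0 : 0 <= h / 2 by rewrite divr_ge0.
  split.
  + by apply: bisector BC AC AB _ => //; rewrite (exprMn _ h) h2; ring.
  + by apply: bisector CA BA BC _.
  + apply: bisector AB CB CA _ => //.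
    by rewrite (mulrC (2 * _) 2) (addrC (2 * _) 2).
by rewrite /area gtr0_norm // detE; field.
Qed.

(** * From the area back to the root of the cubic *)

Lemma sqrt_closure_subfield (R : realType) (G : set R) :
  sqrt_closed_subfield (sqrt_closure G).
Proof.
split; last first.
  move=> x Gx x_gt0 K HK; have [[_ K_sqrt] _] := HK.
  exact: K_sqrt (Gx K HK) x_gt0.
split=> [|x y /set_mem Gx /set_mem Gy|x y /set_mem Gx /set_mem Gy];
  apply/mem_set => K HK; have [[[K1 KB KV] _] _] := HK; apply: set_mem => //.
- by apply: KB; apply/mem_set; [exact: Gx|exact: Gy].
- by apply: KV; apply/mem_set; [exact: Gx|exact: Gy].
Qed.

(** Here (2 - u^2) / h is cot beta, so 1 + cot^2 beta = 4 / h^2 because the leg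
    is 2.  Reducing h^2 = 4 u^2 - u^4 modulo the cubic gives
    32 - h^2 = 15 u^2 + 4 u, and completing the square turns this into
    (15 u + 2)^2 = 4 + 15 (32 - h^2). *)
Lemma root_in_sqrt_closed_subfield (R : realType) (K : set R) (u h : R) :
  sqrt_closed_subfield K -> 0 < u -> cubic (- 4) (- 3) 8 u = 0 -> h != 0 ->
  h ^+ 2 = u ^+ 2 * (4 - u ^+ 2) ->
  K ((2 - u ^+ 2) / h) -> K u.
Proof.
move=> [K_divring K_sqrt] u_gt0 u_root h_neq0 h2 Kcot.
pose k := divring_of K_divring; pose cot := (2 - u ^+ 2) / h.
have inK x : K x <-> x \in k by split=> [/mem_set|/set_mem].
have cotK : cot \in k by apply/inK.
have knat n : n%:R \in k by rewrite rpred_nat.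
have csc2E : cot ^+ 2 + 1 = 4 / h ^+ 2.
  have -> : cot ^+ 2 + 1 = ((2 - u ^+ 2) ^+ 2 + h ^+ 2) / h ^+ 2.
    by rewrite /cot; field.
  by congr (_ / _); rewrite h2; ring.
have h2K : h ^+ 2 \in k.
  have -> : h ^+ 2 = 4 / (cot ^+ 2 + 1).
    by rewrite csc2E invf_div mulrC divfK ?pnatr_eq0.
  by rewrite rpred_div ?rpredD ?rpred1 ?rpredX.
have u3 : u ^+ 3 = 4 * u ^+ 2 + 3 * u - 8.
  by apply/eqP; rewrite -subr_eq0 -u_root /cubic; apply/eqP; ring.
have discE : 4 + 15 * (32 - h ^+ 2) = (15 * u + 2) ^+ 2.
  have -> : h ^+ 2 = 4 * u ^+ 2 - u * u ^+ 3 by rewrite h2; ring.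
  have -> : u * u ^+ 3 = 4 * u ^+ 3 + 3 * u ^+ 2 - 8 * u by rewrite {1}u3; ring.
  by rewrite u3; ring.
have disc_gt0 : 0 < 15 * u + 2 by lra.
have : K (Num.sqrt (4 + 15 * (32 - h ^+ 2))).
  apply: K_sqrt; last by rewrite discE exprn_gt0.
  by apply/inK; rewrite rpredD ?rpredM ?rpredB.
rewrite discE sqrtr_sqr gtr0_norm // => /inK rootK; apply/inK.
have -> : u = (15 * u + 2 - 2) / 15 by field.
by rewrite rpred_div ?rpredB.
Qed.

Theorem theorem1 (R : realType) :
  ~ (forall la lb lc : R, 0 < la -> 0 < lb -> 0 < lc ->
     forall A B C : 'rV[R]_2, triangle A B C -> has_bisectors A B C la lb lc ->
     constructible la lb lc (Num.sqrt (area A B C))).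
Proof.
move=> all_constructible.
have [u /andP[u_ge1 u_le] u_root] := cubic_real_root R.
have u_gt0 : 0 < u by lra.
have u2_lt2 : u ^+ 2 < 2 by nra.
have u2_gt0 : 0 < u ^+ 2 by rewrite exprn_gt0.
have [A [B [C]]] := isosceles_triangle u_gt0 u2_lt2 u_root.
set h := Num.sqrt _ => -[ABC_triangle ABC_bisectors areaE].
have h2 : h ^+ 2 = u ^+ 2 * (4 - u ^+ 2) by rewrite sqr_sqrtr // mulr_ge0; lra.
have h_gt0 : 0 < h by rewrite sqrtr_gt0 mulr_gt0 //; lra.
have h_neq0 : h != 0 by rewrite gt_eqF.
have h2_gt0 : 0 < h / 2 by rewrite divr_gt0.
have := all_constructible _ _ _ h_gt0 h2_gt0 h2_gt0 _ _ _
  ABC_triangle ABC_bisectors.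
rewrite /constructible areaE; set G := [set _; _] => side_constr.
have K_subfield := sqrt_closure_subfield G.
have [K_divring _] := K_subfield.
have cot_constr : sqrt_closure G ((2 - u ^+ 2) / h).
  have -> : (2 - u ^+ 2) / h = (Num.sqrt ((2 - u ^+ 2) * h) / h) ^+ 2.
    by rewrite expr_div_n sqr_sqrtr ?mulr_ge0 ?subr_ge0 ?ltW //; field.
  exact/set_mem/(rpredX (S := divring_of K_divring) 2)/mem_set.
have u_constr :=
  root_in_sqrt_closed_subfield K_subfield u_gt0 u_root h_neq0 h2 cot_constr.
have ratrE (n : int) : @ratrs R n%:~R by exists n%:~R; rewrite ?ratr_int.
apply: (cubic_rootfree_sqrt_closure (@divring_closed_ratrs R)) u_constr u_root.
- exact: (ratrE (- 4)).
- exact: (ratrE (- 3)).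
- exact: (ratrE 8).
- move=> _ [x _ <-] x_root; apply: (@rat_rootfree x).
  apply: (fmorph_inj (@ratr R)).
  by rewrite rmorph_cubic rmorph0 !rmorphN !rmorph_nat.
move=> _ [] ->; exists (1 / 2) => //.
  by rewrite fmorph_div rmorph1 rmorph_nat; field.
by rewrite fmorph_div rmorph1 rmorph_nat; field.
Qed.
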